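(* Let $I=[-1,1]$, let $M$ be a manifold, and let $W=(M\times I)\sqcup Z$ be a compact metric ANR in which $Z$ is a $\mathcal Z$-set. Put $X=\overline{M\times\{0\}}^{\,W}$ (closure in $W$) and $Z_0=X-(M\times\{0\})=X\cap Z$. If there are an open neighborhood $U$ of $Z_0$ in $W$ and a retraction $$r:U\longrightarrow U\cap X\qquad\text{with}\qquad r(U-Z)\subseteq M\times\{0\},$$ then $X=(M\times\{0\})\sqcup Z_0$ is a $\mathcal Z$-compactification of $M$ (identified with $M\times\{0\}$).
   Context: Manifolds may have boundary. $W=(M\times I)\sqcup Z$ means that $Z$ is a closed subset of $W$ and $W-Z$ is identified with $M\times I$ (with its product topology). A closed subset $Z$ of a metric ANR $Y$ is a $\mathcal Z$-set if, for every open set $U\subseteq Y$, the inclusion $U-Z\hookrightarrow U$ is a homotopy equivalence. A compactification $\overline X=X\sqcup Z$ that is a compact metric ANR is a $\mathcal Z$-compactification of $X$ if $Z$ is a $\mathcal Z$-set in $\overline X$. *)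

(* Defs.v *)
From HB Require Import structures.
From mathcomp Require Import all_boot all_order all_algebra.
From mathcomp Require Import all_classical all_reals all_analysis.
Import Order.TTheory GRing.Theory Num.Theory.
Import numFieldNormedType.Exports.

Set Implicit Arguments.
Unset Strict Implicit.
Unset Printing Implicit Defensive.

Local Open Scope classical_set_scope.
Local Open Scope ring_scope.

(* Spaces are given as subsets of ambient topological types, with the induced
   topology.  Functions are total on the ambient types, but only their values
   on the stated domains are ever constrained or used. *)

Definition continuous_map {T S : topologicalType} (A : set T) (B : set S)
    (f : T -> S) : Prop :=
  {within A, continuous f} /\ set_fun A B f.

(* Continuity of the inverse is stated as openness of f : A -> B, so that no
   total extension S -> T of the inverse is required (T may be empty). *)
Definition homeomorphism {T S : topologicalType} (A : set T) (B : set S)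
    (f : T -> S) : Prop :=
  [/\ {within A, continuous f}, set_bij A B f &
      forall O : set T, open O -> open (f @` (A `&` O) : set (subspace B))].

Definition homotopic (R : realType) {T S : topologicalType}
    (A : set T) (B : set S) (f g : T -> S) : Prop :=
  exists H : T * R -> S,
    [/\ continuous_map (A `*` (`[0, 1] : set R)) B H,
        forall x, A x -> H (x, 0) = f x &
        forall x, A x -> H (x, 1) = g x].

Definition retraction {T : topologicalType} (U A : set T) (r : T -> T) : Prop :=
  [/\ A `<=` U, continuous_map U A r & forall x, A x -> r x = x].

Definition homotopy_equivalence (R : realType) {T : topologicalType}
    (A B : set T) (f : T -> T) : Prop :=
  continuous_map A B f /\
  exists g : T -> T,
    [/\ continuous_map B A g,
        homotopic R A A (g \o f) id &
        homotopic R B B (f \o g) id].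

(* For n = 0 the condition is void, so that a 0-manifold is a countable
   discrete space. *)
Definition half_space (R : realType) (n : nat) : set 'rV[R]_n :=
  [set x | forall i : 'I_n, nat_of_ord i = 0%N -> 0 <= x ord0 i].
Arguments half_space : clear implicits.

(* Topological n-manifold, possibly with boundary. *)
Definition manifold (R : realType) (n : nat) (M : topologicalType) : Prop :=
  [/\ hausdorff_space M, @second_countable M &
      forall x : M, exists (V : set M) (B : set 'rV[R]_n) (phi : M -> 'rV[R]_n),
        [/\ open_nbhs x V,
            B `<=` half_space R n,
            open (B : set (subspace (half_space R n))) &
            homeomorphism V B phi]].

(* Absolute neighborhood retract for metric spaces: every closed embedded copy
   of A in a metric space is a retract of some open neighborhood of itself. *)
Definition ANR (R : realType) {T : metricType R} (A : set T) : Prop :=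
  forall (S : metricType R) (C : set S) (i : T -> S),
    closed C -> homeomorphism A C i ->
    exists (V : set S) (r : S -> S), open V /\ retraction V C r.

(* Z is a Z-set in the space Y. *)
Definition Z_set (R : realType) {T : metricType R} (Y Z : set T) : Prop :=
  [/\ Z `<=` Y, closed (Z : set (subspace Y)) &
      forall U : set T, U `<=` Y -> open (U : set (subspace Y)) ->
        homotopy_equivalence R (U `\` Z) U id].

(* Via h, the space Y is a Z-compactification of N with remainder Z. *)
Definition Z_compactification (R : realType) {N : topologicalType}
    {T : metricType R} (h : N -> T) (Y Z : set T) : Prop :=
  [/\ homeomorphism [set: N] (Y `\` Z) h,
      Y `<=` closure (Y `\` Z),
      compact Y,
      ANR Y &
      Z_set Y Z].

(* Main.v *)
Require Import Defs.
From HB Require Import structures.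
From mathcomp Require Import all_boot all_order all_algebra.
From mathcomp Require Import all_classical all_reals all_analysis.
From mathcomp Require Import lra.
Import Order.TTheory GRing.Theory Num.Theory.
Import numFieldNormedType.Exports.

(** The point is that X is a retract of an open set D of W by a retraction
  that carries D - Z into M0 = M x 0, that is, off Z
  ([exists_glued_retraction]).  Both properties of X then follow from those
  of W by composing with this retraction.

  Near the remainder Z0 such a retraction is given, namely r; over W - Z the
  projection p of M x I to M x 0 is another one.  On U - Z the two are joined
  by r o scale s, where scale s (m, t) = (m, s t): scale 1 is the identity and
  scale 0 is p, and r fixes the values of p that lie in U.  Hence
  w |-> r (scale (lam w) w), with a cutoff function lam equal to 1 near Z0 and
  to 0 away from U, interpolates between r and p.  It makes sense only where
  the segments of fibre that it uses stay in U.  A fibre through a point close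
  to Z0 may well leave U, since the fibres need not shrink towards Z.  The
  domain D is chosen accordingly: where lam = 1 no segment is needed, and where
  lam = 0 the projection is used; elsewhere only those points are kept whose
  whole segment is in U.  They form an open set because I is compact, and they
  include the points of M0 there, whose segments are constant.

  Z-set ([Z_set_retract]): an open O in X is a retract of the open set
  V = r'^-1 O of W, and r' maps V - Z to O - Z0; therefore O - Z0 -> O is a
  retract of the homotopy equivalence V - Z -> V.

  ANR ([ANR_nbhd_retract]): a neighbourhood retract of a compact metric ANR is
  an ANR.  Given X embedded by i in a metric space S, the inverse of i is to be
  extended to a map into W on a neighbourhood of i X.  The distance functions
  mdist x embed W in the space of real functions on W with the uniform metric,
  as a closed subset because W is compact, hence, W being an ANR, as
  a neighbourhood retract.  So it suffices to extend the inverse of i as a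
  map into the function space; as i X is compact, the inverse has
  a subadditive modulus of continuity, and McShane's infimum formula does this
  for all points of W at once ([kuratowski_extension]). *)

Local Open Scope classical_set_scope.
Local Open Scope ring_scope.

Set Implicit Arguments.
Unset Strict Implicit.
Unset Printing Implicit Defensive.

(** * Continuity on subsets *)

Lemma continuous_withinP {T S : topologicalType} (A : set T) (f : T -> S) :
  {within A, continuous f} <->
  forall x, A x -> forall N, nbhs (f x) N ->
    \forall y \near x, A y -> N (f y).
Proof.
split=> [/subspace_continuousP fc x Ax N Nx|fc]; first exact: fc.
by apply/subspace_continuousP => x Ax N Nx; apply: fc.
Qed.

Lemma continuous_map_comp {T S V : topologicalType} (A : set T) (B : set S)
    (C : set V) (f : T -> S) (g : S -> V) :
  continuous_map A B f -> continuous_map B C g -> continuous_map A C (g \o f).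
Proof.
move=> [/continuous_withinP fc fAB] [/continuous_withinP gc gBC].
split; last by move=> x Ax; apply/gBC/fAB.
apply/continuous_withinP => x Ax N Nx.
have := fc x Ax _ (gc _ (fAB _ Ax) N Nx).
by apply: filterS => y h Ay; apply: h => //; apply: fAB.
Qed.

Lemma continuous_map_sub {T S : topologicalType} (A A' : set T) (B B' : set S)
    (f : T -> S) :
  A' `<=` A -> (forall x, A' x -> B' (f x)) ->
  continuous_map A B f -> continuous_map A' B' f.
Proof.
by move=> A'A fB' [fc _]; split => //; exact: continuous_subspaceW fc.
Qed.

Lemma continuous_map_preimage {T S : topologicalType} (A : set T) (B O : set S)
    (f : T -> S) :
  open A -> continuous_map A B f -> open O -> open (A `&` f @^-1` O).
Proof.
move=> oA [/continuous_withinP fc _] oO; rewrite openE => x [Ax Ofx].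
have : \forall y \near x, A y by exact: open_nbhs_nbhs.
have := fc x Ax O (open_nbhs_nbhs (conj oO Ofx)).
rewrite /interior; apply: filterS2 => y h Ay; split => //; exact: h.
Qed.

Lemma open_subspace_near {T : topologicalType} (A B : set T) :
  (forall x, A x -> B x -> \forall y \near x, A y -> B y) ->
  open (B : set (subspace A)).
Proof.
move=> AB; rewrite openE => x Bx; rewrite /interior.
change (nbhs_subspace (A := A) x B).
have [Ax|nAx] := pselect (A x); first by rewrite -nbhs_subspace_in//; exact: AB.
by rewrite -nbhs_subspace_out// => _ ->.
Qed.

(** * Z-sets and retracts *)

(** A homotopy inverse of O - Z -> O, for O open in X, is r o g, where g is
  a homotopy inverse of V - Z -> V for V = D `&` r^-1 O.  The homotopies are
  composed with r in the same way: r fixes O, and it maps V to O and V - Z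
  to O - Z. *)
Lemma Z_set_retract (R : realType) (T : metricType R) (Z X D : set T)
    (r : T -> T) :
  Z_set [set: T] Z -> closed Z -> open D ->
  retraction D X r -> (forall x, D x -> ~ Z x -> ~ Z (r x)) ->
  Z_set X (X `&` Z).
Proof.
move=> [_ _ Zeq] cZ oD [XD [rc rX] rid] rZ; split=> [x []//||O OX oO].
  apply/closed_subspaceP; exists Z => //.
  by rewrite setIAC setIid setIC.
have [G oG OG] := (open_subspaceP _ _).1 oO.
pose V := D `&` r @^-1` O.
have OV : O `<=` V.
  by move=> x Ox; split; [exact/XD/OX|rewrite /= rid//; exact: OX].
have oV : open V.
  have := continuous_map_preimage oD (conj rc rX) oG; congr open.
  apply/seteqP; split => x [Dx rx]; split => //.
    have : (G `&` X) (r x) by split => //; exact: rX.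
    by rewrite OG => -[].
  have : (O `&` X) (r x) by split => //; exact: rX.
  by rewrite -OG => -[].
have [_ [g [gc gid1 gid2]]] := Zeq V (@subsetT _ V) (open_subspaceW oV).
have rV : continuous_map V O r.
  by apply: continuous_map_sub (conj rc rX) => [x []|x []].
have rVZ : continuous_map (V `\` Z) (O `\` (X `&` Z)) r.
  apply: continuous_map_sub (conj rc rX) => [x [[]]//|x [[Dx Ox] nZx]].
  by split => // -[_]; exact: rZ.
have OZ : O `\` (X `&` Z) `<=` V `\` Z.
  move=> x [Ox nx]; split; first exact: OV.
  by move=> Zx; apply: nx; split => //; exact: OX.
have rO : forall x, O x -> r x = x by move=> x /OX; exact: rid.
split.
  split; last by move=> x [].
  by apply: continuous_subspaceT => x; exact: cvg_id.
exists (r \o g); split.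
- apply: continuous_map_comp rVZ.
  by apply: continuous_map_sub (gc) => // x Ox; case: gc => _; apply; apply: OV.
- case: gid1 => H [Hc H0 H1]; exists (r \o H); split.
  + apply: continuous_map_comp rVZ; case: (Hc) => _ HV.
    have sub : (O `\` (X `&` Z)) `*` `[0, 1] `<=` (V `\` Z) `*` (`[0, 1] : set R).
      by move=> [x t] [/= /OZ].
    by apply: continuous_map_sub (Hc) => // x /sub /HV.
  + by move=> x /OZ Vx /=; rewrite H0.
  + by move=> x Ox /=; rewrite H1 ?rO//; [case: Ox|exact: OZ].
- case: gid2 => H [Hc H0 H1]; exists (r \o H); split.
  + apply: continuous_map_comp rV; case: (Hc) => _ HV.
    have sub : O `*` `[0, 1] `<=` V `*` (`[0, 1] : set R).
      by move=> [x t] [/= /OV].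
    by apply: continuous_map_sub (Hc) => // x /sub /HV.
  + by move=> x /OV Vx /=; rewrite H0.
  + by move=> x Ox /=; rewrite H1 ?rO//; exact: OV.
Qed.

(** * The uniform metric on real functions *)

(** A type of its own, because the arrow type already carries a topology. *)
Definition kuratowski (R : realType) (T : Type) : Type := T -> R.

Section kuratowski_metric.
Context {R : realType} {T : Type}.
Implicit Types f g h : kuratowski R T.

HB.instance Definition _ := gen_eqMixin (kuratowski R T).
HB.instance Definition _ := gen_choiceMixin (kuratowski R T).

(** The bounds of the uniform distance, together with all reals from 1 on: this
  truncates the distance at 1 and so makes it finite for unbounded functions. *)
Definition sup_gap f g : set R :=
  [set e | 0 < e /\ (1 <= e \/ forall x, `|f x - g x| <= e)].

Definition sup_dist f g : R := inf (sup_gap f g).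

Lemma sup_gap_has_inf f g : has_inf (sup_gap f g).
Proof.
split; first by exists 1; split; [|left].
by exists 0 => e [/ltW].
Qed.

Lemma sup_dist_le f g e :
  0 < e -> (forall x, `|f x - g x| <= e) -> sup_dist f g <= e.
Proof.
by move=> e0 fg; apply: ge_inf; [case: (sup_gap_has_inf f g)|split; [|right]].
Qed.

Lemma sup_dist_lt f g e : sup_dist f g < e -> e <= 1 ->
  forall x, `|f x - g x| < e.
Proof.
move=> /(inf_lt (sup_gap_has_inf f g).1)[d [d0 [d1|fgd]] de] e1 x.
  by have := lt_le_trans de (le_trans e1 d1); rewrite ltxx.
exact: le_lt_trans (fgd x) de.
Qed.

Let sup_distxx f : sup_dist f f = 0.
Proof.
apply/eqP; rewrite eq_le; apply/andP; split.
  apply/ler_addgt0Pl => e e0; rewrite addr0; apply: sup_dist_le => // x.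
  by rewrite subrr normr0 ltW.
by apply: lb_le_inf => [|e [/ltW//]]; exact: (sup_gap_has_inf f f).1.
Qed.

Let sup_dist_positivity f g : sup_dist f g = 0 -> f = g.
Proof.
move=> fg0; apply/funext => x; apply/eqP; rewrite -subr_eq0 -normr_le0.
apply/ler_addgt0Pl => e e0; rewrite addr0.
have m0 : 0 < Num.min e 1 by rewrite lt_min e0 ltr01.
have := @sup_dist_lt f g (Num.min e 1); rewrite fg0 ge_min lexx orbT.
by move=> /(_ m0 isT x)/ltW/le_trans; apply; rewrite ge_min lexx.
Qed.

Let sup_dist_sym f g : sup_dist f g = sup_dist g f.
Proof.
congr inf; apply/seteqP; split => e [e0 [e1|fg]]; split => //; try by left.
  by right => x; rewrite distrC.
by right => x; rewrite distrC.
Qed.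

Let sup_dist_triangle g f h : sup_dist f h <= sup_dist f g + sup_dist g h.
Proof.
apply/ler_addgt0Pl => e e0.
have e20 : 0 < e / 2 by rewrite divr_gt0.
have [a [a0 aP] ae] := inf_adherent e20 (sup_gap_has_inf f g).
have [b [b0 bP] be] := inf_adherent e20 (sup_gap_has_inf g h).
apply: (@le_trans _ _ (a + b)); last by rewrite /sup_dist; lra.
apply: ge_inf; first by case: (sup_gap_has_inf f h).
split; first exact: addr_gt0.
case: aP => [a1|fg]; first by left; lra.
case: bP => [b1|gh]; first by left; lra.
by right => x; rewrite (le_trans (ler_distD (g x) _ _))// lerD.
Qed.

HB.instance Definition _ := isMetric.Build R (kuratowski R T)
  sup_distxx sup_dist_positivity sup_dist_sym sup_dist_triangle.

End kuratowski_metric.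

Section metric_maps.
Context {R : realType}.

Lemma nbhs_mdist (S : metricType R) (x : S) (e : R) :
  0 < e -> \forall y \near x, mdist x y < e.
Proof.
by move=> e0; have := nbhsx_ballx x e e0; rewrite ballEmdist.
Qed.

Lemma nbhs_mdistE (S : metricType R) (x : S) (N : set S) :
  nbhs x N -> exists2 e : R, 0 < e & forall y, mdist x y < e -> N y.
Proof.
move=> /nbhs_ballP[e /= e0 eN]; exists e => // y xy; apply: eN.
by rewrite ballEmdist.
Qed.

Lemma mdist_reverse_triangle (S : metricType R) (x y z : S) :
  `|mdist x z - mdist y z| <= mdist x y.
Proof.
rewrite ler_distl.
have := metric_triangle x y z; have := metric_triangle y x z.
by rewrite (metric_sym y x) => ? ?; apply/andP; split; lra.
Qed.

End metric_maps.

(** * Extending the inverse of an embedding of a compact set *)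

Section compact_inverse_modulus.
Context {R : realType} {W S : metricType R} (X : set W) (i : W -> S).
Hypotheses (cX : compact X) (ic : {within X, continuous i}).
Hypothesis iinj : {in X &, injective i}.

(** Near a pair of distinct points the distance of the images is bounded below,
  so a large L will do; near the diagonal the summand e suffices.  Compactness
  of X x X makes L uniform. *)
Lemma compact_inverse_affine_modulus (e : R) : 0 < e ->
  exists2 L : R, 0 <= L &
    forall x y, X x -> X y -> mdist x y <= e + L * mdist (i x) (i y).
Proof.
move=> e0.
have := (compact_near_coveringP _).1 (compact_setX cX cX) nat \oo
  (fun n p => X p.1 -> X p.2 ->
     mdist p.1 p.2 <= e + n%:R * mdist (i p.1) (i p.2)) _.
have step x y : X x -> X y -> exists d : R, exists n0 : nat, 0 < d /\
    forall x' y' n, X x' -> X y' -> mdist x x' < d -> mdist y y' < d ->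
      (n0 <= n)%N -> mdist x' y' <= e + n%:R * mdist (i x') (i y').
  move=> Xx Xy.
  have tri x' y' : mdist x' y' <= mdist x x' + mdist x y + mdist y y'.
    have := metric_triangle x' x y'; have := metric_triangle x y y'.
    by rewrite (metric_sym x' x); lra.
  have [xye|exy] := ltP (mdist x y) e.
    exists ((e - mdist x y) / 2), 0; split; first lra.
    move=> x' y' n _ _ dx dy _; have := tri x' y'.
    have : 0 <= n%:R * mdist (i x') (i y') by rewrite mulr_ge0// mdist_ge0.
    lra.
  have ixy : 0 < mdist (i x) (i y).
    rewrite mdist_gt0; apply/eqP => /iinj; rewrite !inE => /(_ Xx Xy) xy.
    by move: exy; rewrite xy mdistxx; lra.
  set m := mdist (i x) (i y) in ixy *.
  (* Moving each image by less than m / 4 keeps the images m / 2 apart. *)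
  have m40 : 0 < m / 4 by lra.
  move/continuous_withinP: ic => ic'.
  have [d1 d10 h1] := nbhs_mdistE (ic' _ Xx _ (nbhs_mdist (i x) m40)).
  have [d2 d20 h2] := nbhs_mdistE (ic' _ Xy _ (nbhs_mdist (i y) m40)).
  exists (Num.min 1 (Num.min d1 d2)), (Num.bound ((mdist x y + 2) / (m / 2))).
  split; first by rewrite !lt_min ltr01 d10.
  move=> x' y' n Xx' Xy'; rewrite !lt_min.
  move=> /and3P[x1 /h1/(_ Xx') ix _] /and3P[y1 _ /h2/(_ Xy') iy] n0.
  have im : m / 2 <= mdist (i x') (i y').
    have := metric_triangle (i x) (i x') (i y).
    have := metric_triangle (i x') (i y') (i y).
    by rewrite (metric_sym (i y') (i y)) -/m; lra.
  have nm : mdist x y + 2 <= n%:R * (m / 2).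
    rewrite -ler_pdivrMr; last lra.
    apply: (@le_trans _ _ (Num.bound ((mdist x y + 2) / (m / 2)))%:R).
      apply/ltW/archi_boundP/divr_ge0; last lra.
      by have := mdist_ge0 x y; lra.
    by rewrite ler_nat.
  have : n%:R * (m / 2) <= n%:R * mdist (i x') (i y') by rewrite ler_wpM2l.
  have := tri x' y'; lra.
case.
- move=> [x y] [/= Xx Xy].
  have [d [n0 [d0 dP]]] := step x y Xx Xy.
  exists (ball x d `*` ball y d, [set n | (n0 <= n)%N]) => /=.
    split; last by exists n0.
    by exists (ball x d, ball y d); [split; exact: nbhsx_ballx|].
  move=> [[x' y'] n] /= [[]]; rewrite !ballEmdist /= => dx dy nn Xx' Xy'.
  exact: dP.
- move=> n _ nP; exists n%:R => // x y Xx Xy.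
  exact: (nP n (leqnn n) (x, y)).
Qed.

(** The infimum of the affine bounds e + L e * t over all e > 0.  It is
  subadditive, although an infimum of subadditive functions need not be: of
  two such bounds, used at s and at t, the one with the smaller slope is good
  at s + t. *)
Lemma compact_inverse_modulus : exists om : R -> R,
  [/\ forall t, 0 <= t -> 0 <= om t,
      forall s t, 0 <= s -> s <= t -> om s <= om t,
      forall s t, 0 <= s -> 0 <= t -> om (s + t) <= om s + om t,
      forall e, 0 < e -> exists2 d, 0 < d & forall t, 0 <= t -> t < d -> om t <= e &
      forall x y, X x -> X y -> mdist x y <= om (mdist (i x) (i y))].
Proof.
have /choice[L LP] : forall e : R, exists L : R, 0 < e -> 0 <= L /\
    forall x y, X x -> X y -> mdist x y <= e + L * mdist (i x) (i y).
  move=> e; have [e0|_] := ltP 0 e; last by exists 0.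
  by have [L L0 LP] := compact_inverse_affine_modulus e0; exists L.
pose lines (t : R) := [set e + L e * t | e in [set e : R | 0 < e]].
have lines0 t : lines t !=set0 by exists (1 + L 1 * t), 1 => //=; exact: ltr01.
have lines_lb t : 0 <= t -> lbound (lines t) 0.
  move=> t0 _ [e /= e0 <-]; have [Le _] := LP e e0.
  by rewrite addr_ge0 ?mulr_ge0// ltW.
have om_le t e : 0 <= t -> 0 < e -> inf (lines t) <= e + L e * t.
  by move=> t0 e0; apply: ge_inf; [exists 0; exact: lines_lb|exists e].
exists (fun t => inf (lines t)); split.
- by move=> t t0; apply: lb_le_inf => //; exact: lines_lb.
- move=> s t s0 st /=; apply: lb_le_inf => // _ [e /= e0 <-].
  apply: le_trans (om_le s e s0 e0) _; rewrite lerD2l ler_wpM2l//.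
  by have [] := LP e e0.
- move=> s t s0 t0 /=; rewrite -lerBlDr; apply: lb_le_inf => // _ [e1 /= e10 <-].
  rewrite lerBlDr -lerBlDl; apply: lb_le_inf => // _ [e2 /= e20 <-].
  rewrite lerBlDl.
  have [L12|/ltW L21] := leP (L e1) (L e2).
    have := om_le (s + t) e1 (addr_ge0 s0 t0) e10.
    by have := ler_wpM2r t0 L12; rewrite mulrDr; lra.
  have := om_le (s + t) e2 (addr_ge0 s0 t0) e20.
  by have := ler_wpM2r s0 L21; rewrite mulrDr; lra.
- move=> e e0; have e20 : 0 < e / 2 by lra.
  have [L0 _] := LP _ e20.
  have L10 : 0 < L (e / 2) + 1 by lra.
  exists ((e / 2) / (L (e / 2) + 1)); first exact: divr_gt0.
  move=> t t0; rewrite ltr_pdivlMr// => td.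
  by have := om_le t _ t0 e20; have : L (e / 2) * t <= e / 2; lra.
- move=> x y Xx Xy /=; apply: lb_le_inf => // _ [e /= e0 <-].
  by have [_] := LP e e0; apply.
Qed.

(** The formula is F s w = inf_x (mdist x w + om (mdist s (i x))).  On i X the
  infimum is attained at the point itself, because om is a modulus of
  continuity for the inverse of i.  Subadditivity of om bounds
  F s w - F s' w by om (mdist s s'), whatever w is, so that F is continuous
  for the uniform metric. *)
Lemma kuratowski_extension : exists2 F : S -> kuratowski R W,
  continuous F & forall x, X x -> F (i x) = mdist x.
Proof.
have [[x0 Xx0]|X0] := pselect (X !=set0); last first.
  exists (fun=> (fun=> 0) : kuratowski R W); first exact: cst_continuous.
  by move=> x Xx; case: X0; exists x.
have [om [om0 omle omD omc omX]] := compact_inverse_modulus.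
pose V s w := [set mdist x w + om (mdist s (i x)) | x in X].
have V0 s w : V s w !=set0 by exists (mdist x0 w + om (mdist s (i x0))), x0.
have Vlb s w : lbound (V s w) 0.
  by move=> _ [x Xx <-]; rewrite addr_ge0 ?om0 ?mdist_ge0.
have Vle s w x : X x -> inf (V s w) <= mdist x w + om (mdist s (i x)).
  by move=> Xx; apply: ge_inf; [exists 0; exact: Vlb|exists x].
have om00 : om 0 <= 0.
  apply/ler_addgt0Pl => e e0; rewrite addr0.
  by have [d d0] := omc e e0; apply.
exists (fun s => (fun w => inf (V s w)) : kuratowski R W); last first.
  move=> x Xx; apply/funext => w; apply/eqP; rewrite eq_le; apply/andP; split.
    by apply: le_trans (Vle _ _ _ Xx) _; rewrite mdistxx; lra.
  apply: lb_le_inf => // _ [y Xy <-].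
  by have := omX x y Xx Xy; have := metric_triangle x y w; lra.
have Vlip s s' w : inf (V s w) <= inf (V s' w) + om (mdist s s').
  rewrite -lerBlDr; apply: lb_le_inf => // _ [x Xx <-]; rewrite lerBlDr.
  apply: le_trans (Vle s w x Xx) _; rewrite -addrA lerD2l.
  apply: le_trans (omD _ _ (mdist_ge0 _ _) (mdist_ge0 _ _)).
  by apply: omle; rewrite ?mdist_ge0// addrC metric_triangle.
move=> s N /nbhs_mdistE[e e0 eN].
have e20 : 0 < e / 2 by lra.
have [d d0 dP] := omc _ e20.
have := nbhs_mdist s d0; apply: filterS => s' ss'; apply: eN.
apply: (@le_lt_trans _ _ (e / 2)); last lra.
apply: sup_dist_le => // w; rewrite ler_distl.
have := dP _ (mdist_ge0 s s') ss'.
have := Vlip s s' w; have := Vlip s' s w; rewrite (metric_sym s' s).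
by move=> ? ? ?; apply/andP; split; lra.
Qed.

End compact_inverse_modulus.

(** * Neighbourhood retracts of compact ANRs *)

Section kuratowski_embedding.
Context {R : realType} {W : metricType R}.

Let k (x : W) : kuratowski R W := mdist x.

(** The functions mdist x and mdist y differ by mdist x y at the point y. *)
Lemma mdist_kuratowski_lt (x y : W) (e : R) :
  mdist (k x) (k y) < e -> e <= 1 -> mdist x y < e.
Proof.
move=> xy e1; have := sup_dist_lt xy e1 y; rewrite /k mdistxx subr0.
by rewrite ger0_norm// mdist_ge0.
Qed.

Lemma kuratowski_inj : injective k.
Proof.
move=> x y kxy; apply: mdist_positivity.
have : mdist x y = k x y by []; by rewrite kxy /k mdistxx.
Qed.

Lemma kuratowski_continuous : continuous k.
Proof.
move=> x N /nbhs_mdistE[e e0 eN].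
have e20 : 0 < e / 2 by lra.
have := nbhs_mdist x e20; apply: filterS => y xy; apply: eN.
apply: (@le_lt_trans _ _ (e / 2)); last lra.
apply: sup_dist_le => // w.
by apply: le_trans (mdist_reverse_triangle _ _ _) _; exact: ltW.
Qed.

Lemma kuratowski_inverse (x : W) (N : set W) : nbhs x N ->
  \forall f \near k x, forall y, f = k y -> N y.
Proof.
move=> /nbhs_mdistE[e e0 eN].
have m0 : 0 < Num.min e 1 by rewrite lt_min e0 ltr01.
have := nbhs_mdist (k x) m0; apply: filterS => f xf y fy; apply: eN.
move: xf; rewrite fy => /mdist_kuratowski_lt; rewrite ge_min lexx orbT => /(_ isT).
by rewrite lt_min => /andP[].
Qed.

Lemma kuratowski_homeomorphism : homeomorphism [set: W] (range k) k.
Proof.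
split.
- by apply: continuous_subspaceT; exact: kuratowski_continuous.
- split => [x _|x y _ _|//]; [by exists x|exact: kuratowski_inj].
- move=> O oO; apply: open_subspace_near => _ [x _ <-] [x' [_ Ox'] xx'].
  move: Ox'; rewrite (kuratowski_inj xx') => Ox.
  have := kuratowski_inverse (open_nbhs_nbhs (conj oO Ox)).
  by apply: filterS => f h [y _ yf]; exists y => //; split => //; exact: h.
Qed.

End kuratowski_embedding.

(** With k the embedding of W in its function space, rho a neighbourhood
  retraction onto its image, and F an extension of k o i^-1 to S, the map
  i o r o k^-1 o rho o F retracts a neighbourhood of C onto C. *)
Lemma ANR_nbhd_retract (R : realType) (W : metricType R) (X D : set W)
    (r : W -> W) :
  compact [set: W] -> ANR [set: W] -> compact X ->
  open D -> retraction D X r -> ANR X.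
Proof.
move=> cW aW cX oD [XD rDX rid] S C i clC [ic [iXC iinj isurj] _].
have [[w0 Xw0]|X0] := pselect (X !=set0); last first.
  have C0 : C = set0.
    by rewrite -subset0 => c /isurj[x Xx _]; apply: X0; exists x.
  exists set0, id; split; first exact: open0.
  by rewrite C0; split => //; split => //; exact: continuous_subspace0.
have [F Fc Fi] := kuratowski_extension cX ic iinj.
pose k (x : W) : kuratowski R W := mdist x.
have kc : closed (range k).
  apply: compact_closed; first exact: metric_hausdorff.
  apply: continuous_compact cW; apply: continuous_subspaceT.
  exact: kuratowski_continuous.
have [E [rho [oE [kE rhoE rhoid]]]] := aW _ _ k kc kuratowski_homeomorphism.
pose j f := xget w0 [set w | k w = f].
have kK w : j (k w) = w.
  by rewrite /j; case: xgetP => [y _ /kuratowski_inj//|/(_ w)[]].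
have jc : continuous_map (range k) [set: W] j.
  split => //; apply/continuous_withinP => _ [x _ <-]; rewrite kK => N Nx.
  have := kuratowski_inverse Nx; apply: filterS => f h [y _ yf].
  by rewrite -yf kK; apply: h.
have oFE : open (F @^-1` E) by exact: open_comp.
have Gc : continuous_map (F @^-1` E) [set: W] (j \o (rho \o F)).
  apply: continuous_map_comp jc; apply: continuous_map_comp rhoE.
  by split => //; exact: continuous_subspaceT.
have Gi x : X x -> (j \o (rho \o F)) (i x) = x.
  by move=> Xx; rewrite /= Fi// rhoid ?kK//; exists x.
exists (F @^-1` E `&` (j \o (rho \o F)) @^-1` D), (i \o (r \o (j \o (rho \o F)))).
split; first exact: continuous_map_preimage Gc oD.
split.
- move=> c /isurj[x Xx <-]; split; first by rewrite /= Fi//; apply: kE; exists x.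
  by rewrite /preimage/= -/((j \o (rho \o F)) (i x)) Gi//; exact: XD.
- apply: (@continuous_map_comp _ _ _ _ X) => //.
  apply: continuous_map_comp rDX.
  by apply: continuous_map_sub Gc => [s []|s []].
- move=> c /isurj[x Xx <-].
  by rewrite /= -/((j \o (rho \o F)) (i x)) Gi// rid.
Qed.

(** * Scaling the fibres of M x I *)

Section interval_bundle.
Context {R : realType} {M W : topologicalType} (Z : set W) (e : M * R -> W).
Hypotheses (clZ : closed Z)
  (eh : homeomorphism ([set: M] `*` (`[-1, 1] : set R)) (~` Z) e).

Let dom : set (M * R) := [set: M] `*` `[-1, 1].

(** On the complement of Z this is e o (id x s) o e^-1, written without an
  inverse of e, which need not extend to W when M is empty.  On Z, where there
  is no such w', the default w of xget makes it the identity. *)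
Definition scale (s : R) (w : W) : W :=
  xget w [set w' | exists m t, [/\ dom (m, t), w = e (m, t) & w' = e (m, s * t)]].

Let einj p q : dom p -> dom q -> e p = e q -> p = q.
Proof. by case: eh => _ [_ ei _] _ dp dq; apply: ei; rewrite inE. Qed.

Let eZ p : dom p -> ~ Z (e p).
Proof. by case: eh => _ [ee _ _] _; exact: ee. Qed.

Let esurj w : ~ Z w -> exists m t, dom (m, t) /\ w = e (m, t).
Proof. by case: eh => _ [_ _ es] _ /es[[m t] /= ? <-]; exists m, t. Qed.

Let dom_scale s m t : 0 <= s <= 1 -> dom (m, t) -> dom (m, s * t).
Proof.
move=> /andP[s0 s1] [_ /=]; rewrite !in_itv/= => /andP[t0 t1].
by split => //=; rewrite in_itv/=; apply/andP; split; nra.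
Qed.

Lemma scaleE s m t : dom (m, t) -> scale s (e (m, t)) = e (m, s * t).
Proof.
move=> dmt; rewrite /scale; case: xgetP => [w' _ [m' [t' [dmt' ee ->]]]|h].
  by have [-> ->] := einj dmt dmt' ee.
by case: (h (e (m, s * t))); exists m, t.
Qed.

Lemma scale_Z s w : Z w -> scale s w = w.
Proof.
move=> Zw; rewrite /scale; case: xgetP => [w' _ [m [t [dmt wE _]]]|//].
by exfalso; apply: (eZ dmt); rewrite -wE.
Qed.

Lemma scale1 w : scale 1 w = w.
Proof.
have [/scale_Z//|/esurj[m [t [dmt ->]]]] := pselect (Z w).
by rewrite scaleE// mul1r.
Qed.

Lemma scale_notin s w : 0 <= s <= 1 -> ~ Z w -> ~ Z (scale s w).
Proof.
by move=> s01 /esurj[m [t [dmt ->]]]; rewrite scaleE//; apply/eZ/dom_scale.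
Qed.

Lemma scale_section s m : scale s (e (m, 0)) = e (m, 0).
Proof. by rewrite scaleE ?mulr0//; split => //=; rewrite in_itv/=; lra. Qed.

Lemma scale0 w : ~ Z w -> exists m, scale 0 w = e (m, 0).
Proof. by move=> /esurj[m [t [dmt ->]]]; exists m; rewrite scaleE// mul0r. Qed.

(** Openness of e is relative to ~` Z; it is absolute because Z is closed. *)
Lemma open_image (O : set (M * R)) : open O -> open (e @` (dom `&` O)).
Proof.
case: eh => _ [ee _ _] eo oO; have := eo _ oO.
rewrite openE /= openE => h w wO.
have := h _ wO; rewrite /interior /=.
rewrite -nbhs_subspace_interior//.
have -> : (~` Z)° = ~` Z.
  by rewrite -interior_id; exact: closed_openC.
by case: wO => p [dp _] <-; exact: eZ.
Qed.

Lemma scale_continuous s w (N : set W) : 0 <= s <= 1 -> ~ Z w ->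
  nbhs (scale s w) N ->
  \forall s' \near s & w' \near w, 0 <= s' <= 1 -> N (scale s' w').
Proof.
move=> s01 /esurj[m [t [dmt ->]]]; rewrite scaleE// => Nw.
case: eh => /continuous_withinP ec _ _.
have [[A B] [/= Am Bst] AB] := ec _ (dom_scale s01 dmt) _ Nw.
have st : (fun p : R * R => p.1 * p.2) @ (s, t) --> s * t.
  exact: (@mul_continuous R (s, t)).
have [[S T] [/= Ss Tt] ST] := st _ Bst.
exists (S, e @` (dom `&` (A° `*` T°))) => /=.
  split => //; apply: open_nbhs_nbhs; split.
    apply: open_image; rewrite openE => p [Ap Tp].
    by exists (A°, T°) => //; split; apply: open_nbhs_nbhs; split => //; exact: open_interior.
  by exists (m, t) => //; split => //; split => //=; exact: nbhs_interior.
move=> [s' w'] /= [Ss' [[m' t'] [dmt' [/= Am' Tt']] <-]] s'01.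
rewrite scaleE//; apply: (AB (m', s' * t')); last exact: dom_scale.
split => /=; first exact: interior_subset.
by apply: (ST (s', t')); split => //; exact: interior_subset.
Qed.

Lemma scale_fun_near (lam : W -> R) w (N : set W) :
  {for w, continuous lam} -> (forall w', 0 <= lam w' <= 1) -> ~ Z w ->
  nbhs (scale (lam w) w) N -> \forall w' \near w, N (scale (lam w') w').
Proof.
move=> lamc lam01 nZw Nw.
have [[S A] [/= Ss Aw] SA] := scale_continuous (lam01 w) nZw Nw.
have Sl : \forall w' \near w, S (lam w') by exact: lamc.
move: Aw Sl; apply: filterS2 => w' Aw' Sw'.
exact: (SA (lam w', w') (conj Sw' Aw') (lam01 w')).
Qed.

End interval_bundle.

(** * Gluing the given retraction to the projection *)

Section glued_retraction.
Context {R : realType} {M : topologicalType} {W : metricType R}.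
Context (Z : set W) (e : M * R -> W) (U : set W) (r : W -> W).
Hypotheses (clZ : closed Z)
  (eh : homeomorphism ([set: M] `*` (`[-1, 1] : set R)) (~` Z) e).

Let M0 := e @` ([set: M] `*` [set (0 : R)]).
Let X := closure M0.

Let M0E w : M0 w <-> exists m, w = e (m, 0).
Proof.
split=> [[[m t] [_ /= ->] <-]|[m ->]]; first by exists m.
by exists (m, 0).
Qed.

Lemma section_notin w : M0 w -> ~ Z w.
Proof.
case: eh => _ [ee _ _] _ /M0E[m ->]; apply: ee.
by split => //=; rewrite in_itv/=; lra.
Qed.

(** M0 is closed in M x I: a point (m, t) with t != 0 has the
  neighbourhood of all points with nonzero interval coordinate. *)
Lemma closure_section w : X w -> ~ Z w -> M0 w.
Proof.
case: (eh) => _ [_ einj esurj] _ Xw /esurj[[m t] mt wE].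
have [t0|t0] := eqVneq t 0; first by apply/M0E; exists m; rewrite -wE t0.
have oA : open (e @` (([set: M] `*` `[-1, 1]) `&` snd @^-1` [set s | s != 0])).
  apply: (open_image clZ eh); apply: open_comp; last exact: open_neq.
  by move=> p _; exact: cvg_snd.
have [|w' [[[m1 t1] [_ /= ->] <-] [[m2 t2] [mt2 /= t20] /einj]]] :=
  Xw _ (open_nbhs_nbhs (conj oA _)).
  by exists (m, t).
rewrite !inE => /(_ mt2) e12; suff : (m2, t2) = (m1, 0).
  by case=> _ t2E; move: t20; rewrite t2E eqxx.
by apply: e12; split => //=; rewrite in_itv/=; lra.
Qed.

Hypotheses (oU : open U) (X0U : X `&` Z `<=` U)
  (rU : retraction U (U `&` X) r) (rM0 : r @` (U `\` Z) `<=` M0).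

Local Notation scale := (scale e).

(** The cutoff lam is the truncation to the interval from 0 to 1 of a function
  psi with value -1 off U and 2 on the remainder.  The set D is the union of
  three open sets: psi > 1, and, in the complement of Z, psi < 0 and fibU (the
  segment from w to its projection is in U).  On each of them r' has a formula
  which is visibly continuous: r, scale 0 and r o scale (lam w)
  respectively. *)
Lemma exists_glued_retraction : exists D r',
  [/\ open D, retraction D X r' & forall w, D w -> ~ Z w -> M0 (r' w)].
Proof.
have M0X : M0 `<=` X by exact: subset_closure.
have scaleM0 s w : M0 w -> scale s w = w.
  by move=> /M0E[m ->]; exact: scale_section eh _ _.
have scale0M0 w : ~ Z w -> M0 (scale 0 w).
  by move=> /(scale0 eh)[m ->]; apply/M0E; exists m.
case: rU => _ [/continuous_withinP rc rX] rid.
have lt12 : -1 < 2 :> R by lra.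
have [|psi [psic psiU psiX _]] := @urysohn_ext_itv W R pseudometric_normal
  (~` U) (X `&` Z) (-1) 2 (open_closedC oU) (closedI (@closed_closure _ M0) clZ) _ lt12.
  by rewrite -subset0 => w [nU /X0U].
have {}psiU w : ~ U w -> psi w = -1.
  by move=> nU; apply: psiU; exists w.
have {}psiX w : X w -> Z w -> psi w = 2.
  by move=> Xw Zw; apply: psiX; exists w.
pose lam w : R := Num.max 0 (Num.min 1 (psi w)).
have lam01 w : 0 <= lam w <= 1.
  by rewrite /lam le_max lexx ge_max ler01 ge_min lexx.
have lamc : continuous lam.
  move=> w; apply: (@continuous_max R W (cst 0) (cst 1 \min psi)); first exact: cvg_cst.
  by apply: continuous_min; [exact: cvg_cst|exact: psic].
pose r' w := if psi w <= 0 then scale 0 w else r (scale (lam w) w).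
pose fibU w := forall s, 0 <= s <= 1 -> U (scale s w).
pose D := [set w | 1 < psi w] `|`
  (~` Z `&` ([set w | psi w < 0] `|` [set w | fibU w])).
have psiU' w : -1 < psi w -> U w.
  by move=> pw; apply: contrapT => /psiU; lra.
have oZ : open (~` Z) by exact: closed_openC.
(* Tube lemma: the parameters s range over a compact interval. *)
have fibU_near w : ~ Z w -> fibU w -> \forall w' \near w, fibU w'.
  move=> nZw Uw.
  have near_cover := (compact_near_coveringP _).1 (@segment_compact R 0 1) _ (nbhs w)
    (fun w' s => 0 <= s <= 1 -> U (scale s w')) _.
  apply: filterS; last apply: near_cover => s.
    by move=> w' h s s01; apply: (h s) => //=; rewrite in_itv.
  rewrite /= in_itv/= => s01; apply: (scale_continuous clZ eh s01 nZw).
  by apply: open_nbhs_nbhs; split => //; exact: Uw.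
have r'Z w : D w -> ~ Z w -> M0 (r' w).
  move=> Dw nZ; rewrite /r'; case: (leP (psi w) 0) => p0; first exact: scale0M0.
  apply: rM0; exists (scale (lam w) w) => //; split; last exact: (scale_notin eh).
  case: Dw => [/= p1|[_ [/= p0'|]]].
  - by rewrite /lam min_l ?max_r ?(scale1 eh)//; [apply: psiU'; lra|exact: ltW].
  - lra.
  - exact.
have open_gt1 : open [set w | 1 < psi w].
  exact: (@open_comp _ _ psi _ (fun w _ => psic w) (@open_gt R 1)).
have open_lt0 : open [set w | psi w < 0].
  exact: (@open_comp _ _ psi _ (fun w _ => psic w) (@open_lt R 0)).
exists D, r'; split => //.
  apply: openU => //; rewrite setIUr; apply: openU; first exact: openI.
  rewrite openE => w [nZ Uw]; have := open_nbhs_nbhs (conj oZ nZ).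
  by have := fibU_near w nZ Uw; apply: filterS2 => w' Uw' nZ'; split => //; right.
split.
- move=> w Xw; have [Zw|nZw] := pselect (Z w).
    by left; rewrite /= psiX//; lra.
  right; split => //; have [p0|p0] := ltP (psi w) 0; [by left|right].
  by move=> s _; rewrite scaleM0; [apply: psiU'; lra|exact: closure_section].
- split; last first.
    move=> w Dw; have [Zw|nZw] := pselect (Z w); last exact/M0X/r'Z.
    case: Dw => [/= p1|[]//]; rewrite /r' leNgt (lt_trans ltr01 p1)/=.
    have /psiU'/rX[_] : -1 < psi w by lra.
    by rewrite (scale_Z eh).
  apply/continuous_withinP => w Dw N Nw.
  suff : \forall w' \near w, N (r' w') by apply: filterS.
  case: Dw => [/= p1|[nZ [/= p0|Uw]]].
  - have r'E w' : 1 < psi w' -> r' w' = r w'.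
      move=> pw'; rewrite /r' leNgt (lt_trans ltr01 pw')/=.
      by rewrite /lam min_l ?max_r ?(scale1 eh)//; exact: ltW.
    rewrite r'E// in Nw; have Uw : U w by apply: psiU'; lra.
    have := rc w Uw N Nw.
    have : \forall w' \near w, 1 < psi w' by exact: open_nbhs_nbhs.
    apply: filterS2 => w' pw'; rewrite r'E//; apply; apply: psiU'; lra.
  - have r'E w' : psi w' < 0 -> r' w' = scale 0 w'.
      by move=> /ltW pw'; rewrite /r' pw'.
    rewrite r'E// in Nw.
    have : \forall w' \near w, psi w' < 0 by exact: open_nbhs_nbhs.
    have c0 : {for w, continuous (fun=> 0 : R)} by exact: cvg_cst.
    have c01 (w' : W) : 0 <= (0 : R) <= 1 by rewrite lexx ler01.
    have := scale_fun_near clZ eh c0 c01 nZ Nw.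
    apply: filterS2 => w' Nw' pw'; by rewrite r'E.
  - have r'E w' : ~ Z w' -> fibU w' -> r' w' = r (scale (lam w') w').
      (* If psi w' <= 0, then lam w' = 0 and r fixes scale 0 w', a point of
         M0 in U. *)
      move=> nZ' Uw'; rewrite /r'; case: leP => // p0.
      rewrite /lam max_l ?rid//; last by rewrite ge_min p0 orbT.
      by split; [apply: Uw'; rewrite lexx ler01|exact/M0X/scale0M0].
    rewrite r'E// in Nw.
    have nZ' : \forall w' \near w, ~ Z w' by exact: open_nbhs_nbhs.
    have Nr := rc _ (Uw _ (lam01 w)) N Nw.
    have := scale_fun_near clZ eh (lamc w) lam01 nZ Nr.
    move: nZ' (fibU_near w nZ Uw); apply: filterS3 => w' nZ' Uw'; rewrite r'E//; apply.
    exact: Uw'.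
- move=> w Xw; have rw : -1 < psi w -> r w = w.
    by move=> p; apply: rid; split => //; exact: psiU'.
  rewrite /r'; have [Zw|nZw] := pselect (Z w).
    by rewrite psiX// leNgt ltr0n/= (scale_Z eh)// rw// psiX//; lra.
  case: leP => p0; rewrite scaleM0//; try exact: closure_section.
  by apply: rw; lra.
Qed.

End glued_retraction.

(** * The central section and its closure *)

Lemma section_homeomorphism (R : realType) (M W : topologicalType) (Z : set W)
    (e : M * R -> W) :
  closed Z ->
  homeomorphism ([set: M] `*` (`[-1, 1] : set R)) (~` Z) e ->
  homeomorphism [set: M] (e @` ([set: M] `*` [set 0])) (fun m => e (m, 0)).
Proof.
move=> clZ eh; have [/continuous_withinP ec [_ ei _] _] := eh.
have dom0 m : ([set: M] `*` (`[-1, 1] : set R)) (m, 0).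
  by split => //=; rewrite in_itv/=; lra.
have einj m p : ([set: M] `*` (`[-1, 1] : set R)) p -> e p = e (m, 0) ->
    p = (m, 0).
  by move=> dp; apply: ei; rewrite inE.
split.
- apply/continuous_withinP => m _ N Nm.
  have [[A B] [/= Am B0] AB] := ec _ (dom0 m) N Nm.
  apply: filterS Am => m' Am' _; apply: (AB (m', 0)) (dom0 m').
  by split => //=; exact: nbhs_singleton.
- split => [m _|m m' _ _ /(einj _ _ (dom0 m))[]//|_ [[m t] [_ /= ->] <-]].
    by exists (m, 0).
  by exists m.
- move=> O oO; apply: open_subspace_near => _ _ [m [_ Om] <-].
  have oA : open (e @` (([set: M] `*` `[-1, 1]) `&` fst @^-1` O)).
    by apply: (open_image clZ eh); apply: open_comp => // p _; exact: cvg_fst.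
  have := open_nbhs_nbhs (conj oA (ex_intro2 _ _ (m, 0) (conj (dom0 m) Om) erefl)).
  apply: filterS => _ [p [dp Op] <-] [[m' t] [_ /= ->] /esym/(einj _ _ dp) pE].
  by exists m'; rewrite pE in Op *.
Qed.

Theorem theorem1p5 (R : realType) (n : nat) (M : topologicalType)
    (W : metricType R) (Z : set W) (e : M * R -> W) :
  manifold R n M ->
  compact [set: W] ->
  ANR [set: W] ->
  Z_set [set: W] Z ->
  homeomorphism ([set: M] `*` (`[-1, 1] : set R)) (~` Z) e ->
  let M0 := e @` ([set: M] `*` [set (0 : R)]) in
  let X := closure M0 in
  let Z0 := X `\` M0 in
  forall (U : set W) (r : W -> W),
    open U -> Z0 `<=` U ->
    retraction U (U `&` X) r ->
    r @` (U `\` Z) `<=` M0 ->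
    Z0 = X `&` Z /\ Z_compactification (fun m : M => e (m, 0)) X Z0.
Proof.
move=> _ cW aW zW eh M0 X Z0 U r oU Z0U rU rM0.
have clZ : closed Z.
  have [_ /closed_subspaceP[V clV VZ] _] := zW.
  by move: VZ; rewrite !setIT => <-.
have Z0E : Z0 = X `&` Z.
  apply/seteqP; split => w [Xw nw]; split => //.
    by apply: contrapT => nZw; apply/nw/(closure_section clZ eh).
  by move=> /(section_notin eh).
have M0E : X `\` Z0 = M0.
  by rewrite setDD; apply/setIidPr; exact: subset_closure.
have clX : closed X by exact: closed_closure.
have cX : compact X by exact: subclosed_compact clX cW _.
rewrite Z0E in Z0U.
have [D [r' [oD r'X r'M0]]] := exists_glued_retraction clZ eh oU Z0U rU rM0.
split => //; split => //.
- by rewrite M0E; exact: section_homeomorphism eh.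
- by rewrite M0E.
- exact: ANR_nbhd_retract r'X.
- rewrite Z0E; apply: Z_set_retract r'X _ => // w Dw nZw.
  exact/(section_notin eh)/r'M0.
Qed.
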